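(* Let $k\ge 2$ and let $f^k_{k,n}$ and $l^k_{k,n}$ be the $k$-th sequences of the $k$ sequences of generalized order-$k$ Fibonacci numbers (with all coefficients $c_1=\dots=c_k=1$) and Lucas numbers, respectively, as defined in the context. Then for every integer $n\ge 0$, $$l^k_{k,n}=kf^k_{k,n+1}-(k-1)f^k_{k,n}-\cdots-f^k_{k,n-k+2}=kf^k_{k,n+1}-\sum_{j=2}^{k}(k-j+1)f^k_{k,n+2-j}.$$
   Context: $k$ sequences of generalized order-$k$ Fibonacci numbers: for $1\le i\le k$, $f^i_{k,n}=1$ if $1-k\le n\le 0$ and $i=1-n$, $f^i_{k,n}=0$ if $1-k\le n\le 0$ and $i\neq 1-n$, and $f^i_{k,n}=\sum_{j=1}^k f^i_{k,n-j}$ for $n\ge 1$. $k$ sequences of generalized order-$k$ Lucas numbers: for $1\le i\le k$ and $1-k\le n\le 0$, $l^i_{k,n}=-i$ if $i-n<k$, $l^i_{k,n}=i-2n$ if $i-n=k$, $l^i_{k,n}=k-i-1$ if $i-n>k$; and $l^i_{k,n}=\sum_{j=1}^k l^i_{k,n-j}$ for $n\ge 1$. *)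

(* Defs.v *)
From mathcomp Require Import all_boot all_order all_algebra.
Set Implicit Arguments.
Unset Strict Implicit.
Unset Printing Implicit Defensive.
Import Order.TTheory GRing.Theory Num.Theory.
Local Open Scope ring_scope.

(* The sequence a indexed by the integers n >= 1 - k, with a n = init n for
   1 - k <= n <= 0 and a n = a (n - 1) + ... + a (n - k) for n >= 1.  For n >= 0
   it is computed from the window [:: a n; a (n - 1); ...; a (n - k + 1)].
   Values at n < 1 - k are meaningless. *)
Definition korder_step (w : seq int) : seq int :=
  (\sum_(x <- w) x) :: take (size w).-1 w.

Definition korder_seq (k : nat) (init : int -> int) (n : int) : int :=
  if n is Posz m
  then head 0 (iter m korder_step (mkseq (fun j => init (- j%:Z)) k))
  else init n.

Definition fib_init (i : nat) (n : int) : int :=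
  if i%:Z == 1 - n then 1 else 0.

Definition lucas_init (k i : nat) (n : int) : int :=
  if i%:Z - n < k%:Z then - i%:Z
  else if i%:Z - n == k%:Z then i%:Z - 2 * n
  else k%:Z - i%:Z - 1.

(* gfib k i n and glucas k i n are f^i_{k,n} and l^i_{k,n}, for 1 <= i <= k
   and 1 - k <= n. *)
Definition gfib (k i : nat) : int -> int := korder_seq k (fib_init i).
Definition glucas (k i : nat) : int -> int := korder_seq k (lucas_init k i).

Lemma korder_seq_init (k : nat) (init : int -> int) (n : int) :
  (0 < k)%N -> n <= 0 -> korder_seq k init n = init n.
Proof. by case: k => // k _; case: n => [[|m]|m]. Qed.

Lemma korder_window (k : nat) (init : int -> int) (m : nat) : (0 < k)%N ->
  iter m korder_step (mkseq (fun j => init (- j%:Z)) k)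
  = mkseq (fun j => korder_seq k init (m%:Z - j%:Z)) k.
Proof.
move=> k_gt0; elim: m => [|m IHm].
  apply: eq_mkseq => j; rewrite sub0r korder_seq_init //.
  by rewrite oppr_le0.
rewrite iterS IHm; case: k k_gt0 IHm => // k _ IHm.
have subSS j : m.+1%:Z - j.+1%:Z = m%:Z - j%:Z.
  by rewrite !intS opprD addrACA subrr add0r.
have sub0 (x : int) : x - 0%N%:Z = x by rewrite subr0.
have mkseqS' (F : nat -> int) : mkseq F k.+1 = F 0%N :: mkseq (F \o succn) k.
  by rewrite /mkseq /= (iotaDl 1 0 k) -map_comp.
rewrite [RHS]mkseqS' sub0 (eq_mkseq (fun j => congr1 _ (subSS j))).
rewrite {1}/korder_step size_mkseq; congr (_ :: _).
  by rewrite [RHS]/korder_seq iterS IHm.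
by rewrite /mkseq -map_take take_iota (minn_idPl (leqnSn k)).
Qed.

Lemma korder_seq_rec (k : nat) (init : int -> int) (n : int) :
  (0 < k)%N -> 1 <= n ->
  korder_seq k init n = \sum_(1 <= j < k.+1) korder_seq k init (n - j%:Z).
Proof.
move=> k_gt0; case: n => [[|m]|m] // _.
rewrite {1}/korder_seq iterS korder_window // /korder_step /=.
rewrite big_map big_add1 /= /index_iota subn0.
apply: eq_bigr => j _; congr (korder_seq _ _ _).
by rewrite !intS opprD addrACA subrr add0r.
Qed.

(* Main.v *)
Require Import Defs.
From mathcomp Require Import all_boot all_order all_algebra zify ring.
Import Order.TTheory GRing.Theory Num.Theory.
Local Open Scope ring_scope.

(** Both sides satisfy the order-[k] recurrence, so it is enough to
    compare them on the window [1 - k <= n <= 0].  The right-hand side at such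
    [n] involves Fibonacci numbers of index below [1 - k], so we run the
    recurrence backwards: the extended sequence takes the value [-1] at [- k]
    and [0] at the [k - 2] preceding indices.  With this extension the
    right-hand side is [k] at [0] and [-1] at [1 - k, ..., -1], which are
    exactly the initial values of the [k]-th Lucas sequence. *)

Lemma korder_rec_unique (k : nat) (a b : int -> int) :
  (forall n : int, 1 <= n -> a n = \sum_(1 <= j < k.+1) a (n - j%:Z)) ->
  (forall n : int, 1 <= n -> b n = \sum_(1 <= j < k.+1) b (n - j%:Z)) ->
  (forall n : int, 1 - k%:Z <= n <= 0 -> a n = b n) ->
  forall n : int, 1 - k%:Z <= n -> a n = b n.
Proof.
move=> a_rec b_rec ab0 n le_n.
(* Induction on an upper bound [m] of [n] gives strong induction. *)
have [m le_nm] : exists m : nat, n <= m%:Z by exists `|n|%N; lia.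
elim: m n le_n le_nm => [|m IHm] n le_n le_nm; first by apply: ab0; lia.
have [n_le0|n_gt0] := leP n 0; first by apply: ab0; lia.
rewrite a_rec 1?b_rec; try lia.
by apply: eq_big_nat => j j_range; apply: IHm; lia.
Qed.

Lemma sum_nat_delta (m n i : nat) (c : nat -> int) :
  \sum_(m <= j < n) c j * (j == i)%:R = if (m <= i < n)%N then c i else 0.
Proof.
rewrite (eq_bigr (fun j => if j == i then c j else 0)); last first.
  by move=> j _; case: eqP; rewrite ?mulr1 ?mulr0.
by rewrite -big_mkcond /= big_nat1_eq.
Qed.

Definition lucas_comb (k : nat) (a : int -> int) (n : int) : int :=
  k%:Z * a (n + 1) - \sum_(2 <= j < k.+1) (k%:Z - j%:Z + 1) * a (n + 2 - j%:Z).

(** The recurrence is linear and shift-invariant; [n + 2 - k] is the lowest index at which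
    [lucas_comb] evaluates [a]. *)
Lemma lucas_comb_rec (k : nat) (a : int -> int) (n : int) : (0 < k)%N ->
  (forall p : int, n + 2 - k%:Z <= p ->
     a p = \sum_(1 <= i < k.+1) a (p - i%:Z)) ->
  lucas_comb k a n = \sum_(1 <= i < k.+1) lucas_comb k a (n - i%:Z).
Proof.
move=> k_gt0 a_rec; rewrite /lucas_comb sumrB; congr (_ - _).
  rewrite a_rec; last lia.
  by rewrite mulr_sumr; apply: eq_bigr => i _; congr (_ * a _); ring.
rewrite exchange_big /=; apply: eq_big_nat => j j_range.
rewrite a_rec; last lia.
by rewrite mulr_sumr; apply: eq_bigr => i _; congr (_ * a _); ring.
Qed.

(* [gfib k k] vanishes below [1 - k], so only the value at [- k] changes. *)
Definition gfib_ext (k : nat) (n : int) : int :=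
  gfib k k n - (n == - k%:Z)%:R.

Lemma gfib_ext_ge (k : nat) (n : int) :
  1 - k%:Z <= n -> gfib_ext k n = gfib k k n.
Proof. by move=> le_n; rewrite /gfib_ext (_ : n == _ = false) ?subr0 //; lia. Qed.

Lemma gfib_ext_le0 (k : nat) (n : int) : (0 < k)%N -> n <= 0 ->
  gfib_ext k n = (n == 1 - k%:Z)%:R - (n == - k%:Z)%:R.
Proof.
move=> k_gt0 n_le0; rewrite /gfib_ext /gfib korder_seq_init // /fib_init.
rewrite (_ : (k%:Z == 1 - n) = (n == 1 - k%:Z)); last lia.
by case: (n == 1 - _).
Qed.

(** Every index [n - j] is nonpositive, so only [j = i] (index [1 - k], value 1) and [j = i + 1]
    (index [- k], value -1) can contribute. *)
Lemma sum_gfib_ext (k m N i : nat) (n : int) (c : nat -> int) : (0 < k)%N ->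
  n <= m%:Z -> n + k%:Z = i.+1%:Z ->
  \sum_(m <= j < N) c j * gfib_ext k (n - j%:Z)
  = (if (m <= i < N)%N then c i else 0)
    - (if (m <= i.+1 < N)%N then c i.+1 else 0).
Proof.
move=> k_gt0 le_nm Di; rewrite -!sum_nat_delta -sumrB.
apply: eq_big_nat => j j_range; rewrite gfib_ext_le0 //; last lia.
by rewrite -mulrBr; congr (_ * (_ - _)); congr ((nat_of_bool _)%:R); lia.
Qed.

Lemma gfib_ext_rec (k : nat) (n : int) : (0 < k)%N -> 3 - k%:Z <= n ->
  gfib_ext k n = \sum_(1 <= j < k.+1) gfib_ext k (n - j%:Z).
Proof.
move=> k_gt0 le_n; have [n_gt0|n_le0] := leP 1 n.
  rewrite gfib_ext_ge; last lia.
  rewrite /gfib korder_seq_rec //; apply: eq_big_nat => j j_range.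
  by rewrite gfib_ext_ge //; lia.
have [i Di] : exists i : nat, n + k%:Z = i.+1%:Z.
  by exists `|(n + k%:Z - 1)%R|%N; lia.
under eq_bigr do rewrite -[gfib_ext _ _]mul1r.
rewrite (@sum_gfib_ext _ _ _ i _ (fun=> 1)) ?gfib_ext_le0 //; try lia.
(* Both special indices lie in the window, so 1 and -1 cancel. *)
by rewrite !ifT; lia.
Qed.

Lemma gfib_ext1 (k : nat) : (2 <= k)%N -> gfib_ext k 1 = 1.
Proof.
move=> k_ge2; rewrite gfib_ext_rec; try lia.
under eq_bigr do rewrite -[gfib_ext _ _]mul1r.
rewrite (@sum_gfib_ext _ _ _ k _ (fun=> 1)) //; try lia.
(* The window of 1 contains [1 - k] but stops short of [- k]. *)
by rewrite ifT 1?ifF; lia.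
Qed.

Lemma lucas_comb_gfib_ext (k : nat) (n : int) : (2 <= k)%N ->
  1 - k%:Z <= n <= 0 -> lucas_comb k (gfib_ext k) n = lucas_init k k n.
Proof.
move=> k_ge2 n_range; rewrite /lucas_comb /lucas_init.
have [i Di] : exists i : nat, n + 2 + k%:Z = i.+1%:Z.
  by exists `|(n + 1 + k%:Z)%R|%N; lia.
rewrite (@sum_gfib_ext _ _ _ i _ (fun j => k%:Z - j%:Z + 1)); try lia.
(* At 0 the sum misses both special indices, leaving [k]. For [n < 0] the first term vanishes and
   the sum is 1: a difference of consecutive coefficients, or the last coefficient alone when
   [n = -1]. *)
have [n0|n_neq0] := eqVneq n 0.
  by rewrite n0 add0r gfib_ext1 //; repeat case: ifP; lia.
rewrite gfib_ext_le0; try lia.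
by repeat case: ifP; lia.
Qed.

Theorem theorem2p6 (k : nat) (hk : (2 <= k)%N) (n : int) (hn : 0 <= n) :
  glucas k k n
  = k%:Z * gfib k k (n + 1)
    - \sum_(2 <= j < k.+1) (k%:Z - j%:Z + 1) * gfib k k (n + 2 - j%:Z).
Proof.
have k_gt0 : (0 < k)%N by lia.
(* For [n >= 0] all indices involved are at least [2 - k], where the extension changes nothing. *)
transitivity (lucas_comb k (gfib_ext k) n); last first.
  rewrite /lucas_comb gfib_ext_ge; last lia.
  congr (_ - _); apply: eq_big_nat => j j_range.
  by rewrite gfib_ext_ge //; lia.
apply: (@korder_rec_unique k); last lia.
- by move=> p p_ge1; apply: korder_seq_rec.
- move=> p p_ge1; apply: lucas_comb_rec => // q le_q.
  by apply: gfib_ext_rec; lia.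
move=> p p_range; rewrite lucas_comb_gfib_ext //.
by apply: korder_seq_init => //; lia.
Qed.
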